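(* Let $p\ge 3$ be an odd integer, let $G$ be the dihedral group of order $2p$, and let $G$ act on $F[V]$ as described in the context. Then: (a) The Hilbert ideal $I_H$ is generated by invariants of positive degree at most $p$ (that is, by elements of $F[V]^G$ of positive degree at most $p$). (b) If $m\in M^\rho$ and $u$ is a variable with $u\mid m$, then $um\in I_H$. (c) If $m\in M^\rho$ and $u_1$ and $u_2$ are variables such that $u_1^2\mid m$ and $\rho$ acts on $u_1$ and $u_2$ by multiplication with the same root of unity, then $mu_2\in I_H$.
   Context: Let $p\ge 3$ be an odd integer and let $G=D_{2p}$ be the dihedral group of order $2p$, generated by an element $\sigma$ of order $2$ and an element $\rho$ of order $p$. Let $F$ be a field of characteristic two containing a primitive $p$th root of unity. $G$ acts by graded $F$-algebra automorphisms on the polynomial ring $F[V]=F[x_1,\ldots,x_r,y_1,\ldots,y_r,z_1,\ldots,z_s,w_1,\ldots,w_s]$ (with $r,s\ge 0$) as follows: $\sigma$ interchanges $x_i$ and $y_i$ for $i=1,\ldots,r$ and interchanges $z_i$ and $w_i$ for $i=1,\ldots,s$; $\rho$ fixes all $z_i$ and $w_i$, while $\rho(x_i)=\lambda_i x_i$ and $\rho(y_i)=\lambda_i^{-1}y_i$, where $\lambda_i\in F$ is a nontrivial $p$-th root of unity ($\lambda_i^p=1$, $\lambda_i\ne 1$) for $i=1,\ldots,r$. ''Variable'' means one of the $x_i,y_i,z_i,w_i$. $M$ denotes the set of monomials of $F[V]$ and $M^\rho$ the set of $\rho$-invariant monomials. $F[V]^G$ is the ring of invariants, and the Hilbert ideal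 $I_H$ is the ideal of $F[V]$ generated by all invariants of positive degree. *)

(* Defs.v *)
From HB Require Import structures.
From mathcomp Require Export all_boot all_order all_algebra all_fingroup
  all_solvable.
From mathcomp Require Export mpoly.

Set Implicit Arguments.
Unset Strict Implicit.
Unset Printing Implicit Defensive.

Import GRing.Theory.
Local Open Scope ring_scope.

(* The 2r + 2s variables are laid out as x_1..x_r, y_1..y_r, z_1..z_s, w_1..w_s. *)
Definition nvars (r s : nat) : nat := ((r + r) + (s + s))%N.

Definition ix r s (i : 'I_r) : 'I_(nvars r s) := lshift (s + s) (lshift r i).
Definition iy r s (i : 'I_r) : 'I_(nvars r s) := lshift (s + s) (rshift r i).
Definition iz r s (i : 'I_s) : 'I_(nvars r s) := rshift (r + r) (lshift s i).
Definition iw r s (i : 'I_s) : 'I_(nvars r s) := rshift (r + r) (rshift s i).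

Section Action.
Variables (F : fieldType) (n : nat) (gT : finGroupType).
Variable act : gT -> {lrmorphism {mpoly F[n]} -> {mpoly F[n]}}.

(* A left action by F-algebra endomorphisms, which are automorphisms by the
   first two axioms. *)
Definition graded_action : Prop :=
  [/\ forall f, act 1%g f = f,
      forall g h f, act (g * h)%g f = act g (act h f)
    & forall g d f, f \is d.-homog -> act g f \is d.-homog].

Definition invariant (f : {mpoly F[n]}) : Prop := forall g, act g f = f.

(* "Of degree d" means homogeneous of degree d: invariants with a nonzero
   constant term, such as 1 + h with h a homogeneous invariant, must not count
   as being of positive degree. *)
Definition pos_invariant (f : {mpoly F[n]}) : Prop :=
  invariant f /\ exists2 d, (0 < d)%N & f \is d.-homog.

Definition pos_invariant_le (b : nat) (f : {mpoly F[n]}) : Prop :=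
  invariant f /\ exists2 d, (0 < d <= b)%N & f \is d.-homog.

End Action.

Definition ideal_gen (A : comNzRingType) (S : A -> Prop) (f : A) : Prop :=
  exists (k : nat) (c g : 'I_k -> A),
    (forall i, S (g i)) /\ f = \sum_(i < k) c i * g i.

Definition hilbert_ideal (F : fieldType) (n : nat) (gT : finGroupType)
    (act : gT -> {lrmorphism {mpoly F[n]} -> {mpoly F[n]}}) :
    {mpoly F[n]} -> Prop :=
  ideal_gen (pos_invariant act).

(* Main.v *)
Require Import Defs.
From mathcomp Require Import zify ring.

(** Both generators act monomially: sigma permutes the variables by a
fixed-point-free involution tau, and rho scales each variable u by a p-th root
of unity w(u), with w(tau u) = w(u)^-1. So rho scales a monomial m by the
product w(m) of the weights of its variables, and two families of invariants
are at hand: the orbit sums m + sigma(m) with w(m) = 1, and the quadratic norms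
u sigma(u), fixed by rho because w(u) w(tau u) = 1.

For (b), write m = u m'. In u (m + sigma(m)) the second summand
u sigma(u) sigma(m') is a multiple of the norm of u, so u m is a combination of
an orbit sum and a norm ([hilbert_var_mul]). For (c), m u2 = u1 (m u2 / u1),
where m u2 / u1 is again a rho-invariant monomial divisible by u1, because
u1^2 divides m and u1, u2 have equal weights; so (b) applies
([hilbert_mul_var]).

For (a), a homogeneous invariant is a linear combination of sigma-fixed
monomials and of orbit sums. A sigma-fixed monomial other than 1 is divisible by
a norm, of degree 2. For an orbit sum of degree greater than p, the zero-sum
argument behind the Davenport constant of the cyclic group of order p
([unity_prod_subseq]) splits off a factor m1 of m with w(m1) = 1 and
0 < deg m1 <= p. If m = m1 m2 then, as 2 = 0,
  m + sigma(m) = m2 (m1 + sigma(m1)) + sigma(m1) (m2 + sigma(m2)),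
and induction on the degree puts both orbit sums on the right into the ideal
generated in degrees at most p ([orbit_sum_low_degree]). *)

Set Implicit Arguments.
Unset Strict Implicit.
Unset Printing Implicit Defensive.

Import GRing.Theory.
Local Open Scope ring_scope.

(** * Ideals generated by a predicate *)

Section Ideals.

Variables (A : comNzRingType) (S : A -> Prop).

Lemma ideal_gen_incl f : S f -> ideal_gen S f.
Proof.
move=> Sf; exists 1%N, (fun=> 1), (fun=> f); split=> //.
by rewrite big_ord1 mul1r.
Qed.

Lemma ideal_gen0 : ideal_gen S 0.
Proof.
exists 0%N, (fun=> 0), (fun=> 0); split; first by case.
by rewrite big_ord0.
Qed.

Lemma ideal_genD f g : ideal_gen S f -> ideal_gen S g -> ideal_gen S (f + g).
Proof.
move=> [k [c [x [Sx ->]]]] [l [d [y [Sy ->]]]].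
pose glue (a : 'I_k -> A) (b : 'I_l -> A) i :=
  match split i with inl j => a j | inr j => b j end.
exists (k + l)%N, (glue c d), (glue x y); split.
  by move=> i; rewrite /glue; case: (split i).
rewrite big_split_ord /=; congr (_ + _); apply: eq_bigr => i _; rewrite /glue.
  by rewrite -[lshift l i]/(unsplit (inl i)) unsplitK.
by rewrite -[rshift k i]/(unsplit (inr i)) unsplitK.
Qed.

Lemma ideal_genM a f : ideal_gen S f -> ideal_gen S (a * f).
Proof.
move=> [k [c [x [Sx ->]]]]; exists k, (fun i => a * c i), x; split=> //.
by rewrite mulr_sumr; apply: eq_bigr => i _; rewrite mulrA.
Qed.

Lemma ideal_gen_sum (I : eqType) (s : seq I) (P : pred I) (f : I -> A) :
  {in s, forall i, P i -> ideal_gen S (f i)} ->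
  ideal_gen S (\sum_(i <- s | P i) f i).
Proof.
move=> Jf; rewrite big_seq_cond.
apply: (big_ind (ideal_gen S)); [exact: ideal_gen0 | exact: ideal_genD |].
by move=> i /andP[]; exact: Jf.
Qed.

End Ideals.

Lemma ideal_gen_trans (A : comNzRingType) (S T : A -> Prop) f :
  (forall g, S g -> ideal_gen T g) -> ideal_gen S f -> ideal_gen T f.
Proof.
move=> ST [k [c [x [Sx ->]]]].
by apply: ideal_gen_sum => i _ _; apply/ideal_genM/ST/Sx.
Qed.

(** * Zero-sum subsequences *)

Lemma unity_neq0 (F : fieldType) (x : F) p : (0 < p)%N -> x ^+ p = 1 -> x != 0.
Proof.
move=> p_gt0; apply: contra_eq_neq => ->.
by rewrite expr0n eqn0Ngt p_gt0 eq_sym oner_eq0.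
Qed.

(** The p + 1 partial products of the first p terms are all roots of X^p - 1,
which has at most p roots, so two of them agree; the terms between these two
positions have product 1. *)
Lemma unity_prod_subseq (F : fieldType) (I : Type) (w : I -> F) p (s : seq I) :
    (0 < p <= size s)%N -> (forall i, w i ^+ p = 1) ->
  exists s1 s2 s3, [/\ s = s1 ++ s2 ++ s3, (0 < size s2 <= p)%N &
                       \prod_(i <- s2) w i = 1].
Proof.
move=> /andP[p_gt0 le_p_s] wp.
pose P (k : 'I_p.+1) := \prod_(i <- take k s) w i.
have Pp k : P k ^+ p = 1 by rewrite -prodrXl; apply: big1.
have /injectivePn[i [j neq_ij Pij]] : ~~ injectiveb P.
  apply/negP => injP.
  have : (size (codom P) < size ('X^p - 1%:P : {poly F})%R)%N.
    apply: max_poly_roots => //; first by rewrite -size_poly_eq0 size_XnsubC.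
    by apply/allP => _ /codomP[k ->]; rewrite /root !hornerE Pp subrr.
  by rewrite size_codom card_ord size_XnsubC // ltnn.
wlog lt_ij : i j neq_ij Pij / (i < j)%N.
  move=> IH; case: (ltngtP i j) => [||/val_inj eq_ij]; first exact: IH.
    by apply: IH; rewrite // eq_sym.
  by rewrite eq_ij eqxx in neq_ij.
have le_jp : (j <= p)%N by rewrite -ltnS.
exists (take i s), (take (j - i) (drop i s)), (drop j s); split.
- by rewrite -{2}(subnK (ltnW lt_ij)) -drop_drop !cat_take_drop.
- rewrite size_take_min size_drop; lia.
- have nzP : P i != 0 by exact: unity_neq0 p_gt0 (Pp i).
  apply: (mulfI nzP); rewrite mulr1 {2}Pij -big_cat /=.
  by rewrite /P -{2}(subnKC (ltnW lt_ij)) takeD.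
Qed.

(** * Weights of monomials *)

Definition mnm_weight n (F : fieldType) (w : 'I_n -> F) (m : 'X_{1..n}) : F :=
  \prod_i w i ^+ m i.

Section Weight.

Variables (n : nat) (F : fieldType) (w : 'I_n -> F).
Implicit Types m : 'X_{1..n}.

Lemma mnm_weightD m1 m2 :
  mnm_weight w (m1 + m2) = mnm_weight w m1 * mnm_weight w m2.
Proof.
by rewrite -big_split; apply: eq_bigr => i _; rewrite mnmDE exprD.
Qed.

Lemma mnm_weight0 : mnm_weight w 0%MM = 1.
Proof. by apply: big1 => i _; rewrite mnm0E. Qed.

Lemma mnm_weightU i : mnm_weight w U_(i) = w i.
Proof.
rewrite /mnm_weight (bigD1 i) //= mnm1E eqxx big1 ?mulr1 // => j /negPf ne_ji.
by rewrite mnm1E eq_sym ne_ji.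
Qed.

Lemma mnm_weight_sumU (s : seq 'I_n) :
  mnm_weight w (\sum_(i <- s) U_(i))%MM = \prod_(i <- s) w i.
Proof.
rewrite (big_morph _ mnm_weightD mnm_weight0).
by apply: eq_bigr => i _; rewrite mnm_weightU.
Qed.

End Weight.

Lemma mnm_sumU n (m : 'X_{1..n}) :
  exists s : seq 'I_n, m = (\sum_(i <- s) U_(i))%MM.
Proof.
exists (flatten [seq nseq (m i) i | i <- enum 'I_n]).
rewrite big_flatten big_map big_enum /= [LHS]multinomUE_id.
by apply: eq_bigr => i _; rewrite big_nseq -Monoid.iteropE.
Qed.

Lemma mdeg_sumU n (s : seq 'I_n) : mdeg (\sum_(i <- s) U_(i))%MM = size s.
Proof.
rewrite mdeg_sum -sum1_size.
by apply: eq_bigr => i _; rewrite mdeg1.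
Qed.

Lemma mnm_weight1_factor n (F : fieldType) (w : 'I_n -> F) p (m : 'X_{1..n}) :
  (0 < p <= mdeg m)%N -> (forall i, w i ^+ p = 1) ->
  exists m1 m2, [/\ m = (m1 + m2)%MM, (0 < mdeg m1 <= p)%N &
                    mnm_weight w m1 = 1].
Proof.
have [s ->] := mnm_sumU m; rewrite mdeg_sumU => hp wp.
have [s1 [s2 [s3 [-> sz_s2 w_s2]]]] := unity_prod_subseq hp wp.
exists (\sum_(i <- s2) U_(i))%MM, (\sum_(i <- s1 ++ s3) U_(i))%MM.
rewrite mdeg_sumU mnm_weight_sumU; split=> //.
by rewrite !big_cat /= [LHS]Monoid.mulmCA.
Qed.

(** * Diagonal and permuting endomorphisms *)

Section Endomorphisms.

Variables (n : nat) (F : fieldType).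
Variable theta : {lrmorphism {mpoly F[n]} -> {mpoly F[n]}}.

Lemma diagonal_mpolyX (w : 'I_n -> F) (m : 'X_{1..n}) :
  (forall i, theta 'X_i = w i *: 'X_i) ->
  theta 'X_[m] = mnm_weight w m *: 'X_[m].
Proof.
move=> thetaX; rewrite mpolyXE_id rmorph_prod -scaler_prod.
by apply: eq_bigr => i _; rewrite rmorphXn /= thetaX exprZn.
Qed.

Lemma diagonal_fixed_msupp (w : 'I_n -> F) (f : {mpoly F[n]}) :
    (forall i, theta 'X_i = w i *: 'X_i) -> theta f = f ->
  {in msupp f, forall m, mnm_weight w m = 1}.
Proof.
move=> thetaX theta_f m; rewrite mcoeff_msupp => fm_neq0.
have : (theta f)@_m = mnm_weight w m * f@_m.
  rewrite [f in LHS]mpolyE [f in RHS]mpolyE !raddf_sum /= mulr_sumr.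
  apply: eq_bigr => k _.
  rewrite linearZ /= (diagonal_mpolyX _ thetaX) !mcoeffZ mcoeffX.
  by case: eqP => [->|]; rewrite ?mulr0 // !mulr1 mulrC.
by rewrite theta_f -{1}[f@_m]mul1r => /(mulIf fm_neq0).
Qed.

Lemma permuting_msym (tau : 'S_n) f :
  (forall i, theta 'X_i = 'X_(tau i)) -> theta f = msym tau f.
Proof.
move=> thetaX; rewrite [f]mpolyE !raddf_sum; apply: eq_bigr => m _.
rewrite /= !linearZ /=; congr (_ *: _); rewrite mpolyXE_id !rmorph_prod.
apply: eq_bigr => i _; rewrite !rmorphXn /= thetaX; congr (_ ^+ _).
by rewrite /msym mmapX mmap1U.
Qed.

End Endomorphisms.

(** * Orbit sums, norms and the Hilbert ideal *)

Section Invariants.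

Variables (F : fieldType) (n : nat) (gT : finGroupType) (sigma rho : gT).
Variable act : gT -> {lrmorphism {mpoly F[n]} -> {mpoly F[n]}}.
Hypothesis gen_sigma_rho : (<<[set sigma; rho]>> = [set: gT])%g.
Hypothesis graded_act : graded_action act.

(** The stabiliser of f is a subgroup, so it is everything once it contains the
generators. *)
Lemma invariant_gen f :
  act sigma f = f -> act rho f = f -> invariant act f.
Proof.
case: graded_act => act1 actM _ sigma_f rho_f g.
have stabP : group_set [set h | act h f == f].
  apply/group_setP; split=> [|h k]; rewrite !inE ?act1 // => /eqP hf /eqP kf.
  by rewrite actM kf hf.
have : (<<[set sigma; rho]>> \subset Group stabP)%g.
  rewrite gen_subG; apply/subsetP => h.
  by rewrite !inE => /orP[] /eqP ->; rewrite ?sigma_f ?rho_f.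
by rewrite gen_sigma_rho => /subsetP/(_ g (in_setT _)); rewrite inE => /eqP.
Qed.

Variables (tau : 'S_n) (w : 'I_n -> F).
Hypothesis tauK : involutive tau.
Hypothesis tau_neq : forall i, tau i != i.
Hypothesis sigmaX : forall i, act sigma 'X_i = 'X_(tau i).
Hypothesis rhoX : forall i, act rho 'X_i = w i *: 'X_i.
Hypothesis w_tau : forall i, w (tau i) = (w i)^-1.

Local Notation "m # s" := [multinom m (s i) | i < n]
  (at level 40, left associativity, format "m # s").

Implicit Types m : 'X_{1..n}.

Lemma mtauK m : (m#tau)#tau = m.
Proof. by apply/mnmP => i; rewrite !mnmE tauK. Qed.

Lemma mtau_inj : injective (fun m => m#tau).
Proof. by apply: (can_inj (g := fun m => m#tau)); exact: mtauK. Qed.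

Lemma sigma_mpolyX m : act sigma 'X_[m] = 'X_[m#tau].
Proof.
rewrite (permuting_msym _ sigmaX) msymX; congr 'X_[_].
apply/mnmP => i; rewrite !mnmE; congr (m _).
by apply: (perm_inj (s := tau)); rewrite permKV tauK.
Qed.

Lemma weight_mtau m : mnm_weight w (m#tau) = (mnm_weight w m)^-1.
Proof.
rewrite /mnm_weight (reindex_inj (@perm_inj _ tau)) -prodfV.
by apply: eq_bigr => i _; rewrite mnmE tauK w_tau exprVn.
Qed.

Lemma rho_mpolyX m : mnm_weight w m = 1 -> act rho 'X_[m] = 'X_[m].
Proof. by move=> wm; rewrite (diagonal_mpolyX _ rhoX) wm scale1r. Qed.

Lemma rho_mpolyX_weight m : act rho 'X_[F, m] = 'X_[m] -> mnm_weight w m = 1.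
Proof.
by move/(diagonal_fixed_msupp rhoX); apply; rewrite msuppX inE.
Qed.

Lemma orbit_sum_invariant m :
  mnm_weight w m = 1 -> invariant act ('X_[m] + 'X_[m#tau]).
Proof.
move=> wm; apply: invariant_gen; rewrite rmorphD /=.
  by rewrite !sigma_mpolyX mtauK addrC.
by rewrite !rho_mpolyX // weight_mtau wm invr1.
Qed.

Lemma orbit_sum_homog m :
  ('X_[m] + 'X_[m#tau] : {mpoly F[n]}) \is (mdeg m).-homog.
Proof. by rewrite rpredD // dhomogX //= mdeg_mperm. Qed.

Hypothesis w_neq0 : forall i, w i != 0.

Lemma norm_invariant u :
  invariant act ('X_u * 'X_(tau u)).
Proof.
apply: invariant_gen; rewrite rmorphM /=.
  by rewrite !sigmaX tauK mulrC.
by rewrite !rhoX -scalerAl -scalerAr scalerA w_tau divff // scale1r.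
Qed.

Lemma norm_homog u : ('X_u * 'X_(tau u) : {mpoly F[n]}) \is 2.-homog.
Proof. by rewrite -mpolyXD dhomogX /= mdegD !mdeg1. Qed.

Lemma hilbert_norm u : hilbert_ideal act ('X_u * 'X_(tau u)).
Proof.
apply: ideal_gen_incl; split; first exact: norm_invariant.
by exists 2%N => //; exact: norm_homog.
Qed.

(** With m = u m', the product u (m + sigma(m)) equals u m plus
sigma(m') (u sigma(u)), so u m is a combination of an orbit sum and a norm. *)
Lemma hilbert_var_mul m u :
  mnm_weight w m = 1 -> (U_(u) <= m)%MM -> hilbert_ideal act ('X_u * 'X_[m]).
Proof.
move=> wm le_um; set m' := (m - U_(u))%MM.
have def_m : m = (m' + U_(u))%MM by rewrite submK.
have -> : 'X_u * 'X_[m] =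
    'X_u * ('X_[m] + 'X_[m#tau]) + - act sigma 'X_[m'] * ('X_u * 'X_(tau u)).
  have -> : 'X_[m#tau] = act sigma 'X_[m'] * 'X_(tau u).
    by rewrite -sigma_mpolyX {1}def_m mpolyXD rmorphM /= sigmaX.
  by ring.
apply: ideal_genD; apply: ideal_genM; last exact: hilbert_norm.
apply: ideal_gen_incl; split; first exact: orbit_sum_invariant.
exists (mdeg m); last exact: orbit_sum_homog.
by rewrite def_m mdegD mdeg1 addn1.
Qed.

(** The monomial m u2 / u1 has weight 1 and is still divisible by u1, and
m u2 is its product with u1. *)
Lemma hilbert_mul_var m u1 u2 :
    mnm_weight w m = 1 -> (U_(u1) *+ 2 <= m)%MM -> w u1 = w u2 ->
  hilbert_ideal act ('X_[m] * 'X_u2).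
Proof.
move=> wm le_um eq_w; set m' := (m - U_(u1) *+ 2)%MM.
have def_m : m = (m' + (U_(u1) + U_(u1)))%MM.
  exact: esym (submK le_um).
rewrite def_m !mpolyXD.
have -> : 'X_[m'] * ('X_u1 * 'X_u1) * 'X_u2 =
    'X_u1 * 'X_[m' + U_(u1) + U_(u2)] :> {mpoly F[n]}.
  by rewrite !mpolyXD; ring.
apply: hilbert_var_mul.
  by rewrite -wm def_m !mnm_weightD !mnm_weightU eq_w mulrA.
by rewrite lep1mP !mnmDE mnm1E eqxx; lia.
Qed.

Variable p : nat.
Hypothesis p_ge2 : (2 <= p)%N.
Hypothesis wp : forall i, w i ^+ p = 1.
Hypothesis char2 : 2%N \in [pchar F].

Local Notation J := (ideal_gen (pos_invariant_le act p)).

(** Induction on the degree: while m has degree greater than p it factors as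
m1 m2 with m1 of weight 1 and degree at most p, and in characteristic 2 its
orbit sum is a combination of those of m1 and m2. *)
Lemma orbit_sum_low_degree m :
  mnm_weight w m = 1 -> (0 < mdeg m)%N -> J ('X_[m] + 'X_[m#tau]).
Proof.
have [d] := ubnP (mdeg m); elim: d m => // d IH m lt_md wm m_gt0.
have [le_mp|lt_pm] := leqP (mdeg m) p.
  apply: ideal_gen_incl; split; first exact: orbit_sum_invariant.
  by exists (mdeg m); [rewrite m_gt0 | exact: orbit_sum_homog].
have hp : (0 < p <= mdeg m)%N by lia.
have [m1 [m2 [def_m deg_m1 wm1]]] := mnm_weight1_factor hp wp.
have wm2 : mnm_weight w m2 = 1.
  by move: wm; rewrite def_m mnm_weightD wm1 mul1r.
have deg_m : mdeg m = (mdeg m1 + mdeg m2)%N by rewrite def_m mdegD.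
have -> : m#tau = (m1#tau + m2#tau)%MM.
  by apply/mnmP => i; rewrite def_m !(mnmE, mnmDE).
have -> : 'X_[m] + 'X_[m1#tau + m2#tau] =
    'X_[m2] * ('X_[m1] + 'X_[m1#tau]) + 'X_[m1#tau] * ('X_[m2] + 'X_[m2#tau])
    :> {mpoly F[n]}.
  (* The two sides differ by twice sigma(m1) m2. *)
  have two0 : 2%:R = 0 :> {mpoly F[n]}.
    by rewrite -mpolyC_nat (pcharf0 char2).
  rewrite def_m !mpolyXD; apply/eqP; rewrite -subr_eq0; apply/eqP.
  transitivity (- (2%:R * ('X_[m1#tau] * 'X_[m2])) : {mpoly F[n]}).
    by ring.
  by rewrite two0 mul0r oppr0.
by apply: ideal_genD; apply: ideal_genM; apply: IH => //; lia.
Qed.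

(** If u divides the fixed monomial m then so does sigma(u), which is another
variable; hence the norm of u divides m. *)
Lemma fixed_monomial_low_degree m :
  m#tau = m -> (0 < mdeg m)%N -> J 'X_[m].
Proof.
move=> m_fix; rewrite lt0n mdeg_eq0 => m_neq0.
have [u mu] : exists u, m u != 0%N.
  apply/existsP; apply: contraR m_neq0 => /existsPn m0.
  by apply/eqP/mnmP => i; rewrite mnm0E; apply/eqP; rewrite -[_ == _]negbK m0.
have le_um : (U_(u) + U_(tau u) <= m)%MM.
  apply/mnm_lepP => i; rewrite mnmDE !mnm1E.
  have mtu : m (tau u) != 0%N by rewrite -[in m _]m_fix mnmE tauK.
  case: (u =P i) => [<-|_]; first by rewrite (negPf (tau_neq u)) addn0 lt0n.
  by case: eqP => // <-; rewrite lt0n.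
rewrite -(submK le_um) !mpolyXD; apply/ideal_genM/ideal_gen_incl.
split; first exact: norm_invariant.
by exists 2%N => //; exact: norm_homog.
Qed.

(** The coefficients of f are constant on sigma-orbits and its monomials have
weight 1, so f is a combination of fixed monomials and of orbit sums. *)
Lemma invariant_low_degree f : pos_invariant act f -> J f.
Proof.
case=> f_inv [d d_gt0 f_homog].
have wf : {in msupp f, forall m, mnm_weight w m = 1}.
  exact: diagonal_fixed_msupp rhoX (f_inv rho).
have deg_f : {in msupp f, forall m, 0 < mdeg m}%N.
  by move=> m mf; rewrite (dhomogP _ _ _ f_homog m mf).
have f_tau m : f@_(m#tau) = f@_m.
  by rewrite -{2}(f_inv sigma) (permuting_msym f sigmaX) mcoeff_sym.
pose term m := f@_m *: 'X_[m] : {mpoly F[n]}.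
(* The monomial order selects one representative, the smaller monomial, in each
   orbit of size 2. *)
have f_split : f = \sum_(m <- msupp f | m#tau == m) term m
    + \sum_(m <- msupp f | (m < m#tau)%O) (term m + term (m#tau)).
  have perm_tau : perm_eq (msupp f) [seq m#tau | m <- msupp f].
    apply: uniq_perm; rewrite ?(map_inj_uniq mtau_inj) ?msupp_uniq //.
    move=> m; rewrite -[m in RHS]mtauK (mem_map mtau_inj).
    by rewrite !mcoeff_msupp f_tau.
  rewrite big_split /= [f in LHS]mpolyE (bigID (fun m => m#tau == m)) /=.
  congr (_ + _); rewrite (bigID (fun m => m < m#tau)%O) /=; congr (_ + _).
    by apply: eq_bigl => m; case: Order.TotalTheory.ltgtP; rewrite ?andbT.
  rewrite (perm_big _ perm_tau) big_map; apply: eq_bigl => m.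
  by rewrite mtauK; case: Order.TotalTheory.ltgtP.
rewrite f_split; apply: ideal_genD; apply: ideal_gen_sum => m mf.
  move=> /eqP m_fix; rewrite /term -mul_mpolyC; apply: ideal_genM.
  by apply: fixed_monomial_low_degree => //; exact: deg_f.
move=> _; rewrite /term f_tau -scalerDr -mul_mpolyC; apply: ideal_genM.
by apply: orbit_sum_low_degree; [exact: wf | exact: deg_f].
Qed.

Lemma hilbert_ideal_low_degree f : hilbert_ideal act f <-> J f.
Proof.
split; apply: ideal_gen_trans => g; first exact: invariant_low_degree.
case=> g_inv [d /andP[d_gt0 _] g_homog].
by apply: ideal_gen_incl; split=> //; exists d.
Qed.

End Invariants.

(** * The involution and the weights of the given representation *)

Section SwapVariables.

Variables (r s : nat).

Definition swap_var (i : 'I_(nvars r s)) : 'I_(nvars r s) :=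
  match split i with
  | inl j => match split j with inl a => iy s a | inr a => ix s a end
  | inr j => match split j with inl a => iw r a | inr a => iz r a end
  end.

Definition var_weight (F : fieldType) (lambda : 'I_r -> F)
    (i : 'I_(nvars r s)) : F :=
  match split i with
  | inl j => match split j with inl a => lambda a | inr a => (lambda a)^-1 end
  | inr _ => 1
  end.

Lemma nvars_ind (P : 'I_(nvars r s) -> Prop) :
    (forall a, P (ix s a)) -> (forall a, P (iy s a)) ->
    (forall a, P (iz r a)) -> (forall a, P (iw r a)) ->
  forall i, P i.
Proof.
move=> Px Py Pz Pw i; rewrite -(splitK i).
by case: (split i) => j; rewrite -(splitK j); case: (split j).
Qed.

Lemma split_lshift m n (a : 'I_m) : split (lshift n a) = inl a.
Proof. exact: (unsplitK (inl a)). Qed.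

Lemma split_rshift m n (a : 'I_n) : split (rshift m a) = inr a.
Proof. exact: (unsplitK (inr a)). Qed.

Definition split_varE := (split_lshift, split_rshift).

Lemma swap_varE :
  ((forall a, swap_var (ix s a) = iy s a) *
   (forall a, swap_var (iy s a) = ix s a)) *
  ((forall a, swap_var (iz r a) = iw r a) *
   (forall a, swap_var (iw r a) = iz r a)).
Proof. by split; split=> a; rewrite /swap_var !split_varE. Qed.

Lemma swap_varK : involutive swap_var.
Proof. by apply: nvars_ind => a; rewrite !swap_varE. Qed.

Lemma swap_var_neq i : swap_var i != i.
Proof.
move: i; apply: nvars_ind => a; rewrite swap_varE -val_eqE /=;
by have := ltn_ord a; lia.
Qed.

Lemma var_weightE (F : fieldType) (lambda : 'I_r -> F) :
  ((forall a, var_weight lambda (ix s a) = lambda a) *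
   (forall a, var_weight lambda (iy s a) = (lambda a)^-1)) *
  ((forall a, var_weight lambda (iz r a) = 1) *
   (forall a, var_weight lambda (iw r a) = 1)).
Proof. by split; split=> a; rewrite /var_weight !split_varE. Qed.

End SwapVariables.

Theorem proposition1
  (p : nat) (hp3 : (3 <= p)%N) (hpodd : odd p)
  (gT : finGroupType) (hG : ([set: gT] \isog 'D_(p.*2))%g)
  (sigma rho : gT)
  (hgen : (<<[set sigma; rho]>> = [set: gT])%g)
  (hsigma : #[sigma]%g = 2%N) (hrho : #[rho]%g = p)
  (F : fieldType) (hchar : 2%N \in [pchar F])
  (hroot : exists zeta : F, p.-primitive_root zeta)
  (r s : nat)
  (lambda : 'I_r -> F)
  (hlambda : forall i, lambda i ^+ p = 1 /\ lambda i <> 1)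
  (act : gT -> {lrmorphism {mpoly F[nvars r s]} -> {mpoly F[nvars r s]}})
  (hact : graded_action act)
  (hsigma_xy : forall i : 'I_r,
     act sigma 'X_(ix s i) = 'X_(iy s i) /\ act sigma 'X_(iy s i) = 'X_(ix s i))
  (hsigma_zw : forall i : 'I_s,
     act sigma 'X_(iz r i) = 'X_(iw r i) /\ act sigma 'X_(iw r i) = 'X_(iz r i))
  (hrho_xy : forall i : 'I_r,
     act rho 'X_(ix s i) = lambda i *: 'X_(ix s i) /\
     act rho 'X_(iy s i) = (lambda i)^-1 *: 'X_(iy s i))
  (hrho_zw : forall i : 'I_s,
     act rho 'X_(iz r i) = 'X_(iz r i) /\ act rho 'X_(iw r i) = 'X_(iw r i)) :
  [/\ 
      forall f : {mpoly F[nvars r s]},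
        hilbert_ideal act f <-> ideal_gen (pos_invariant_le act p) f,
      forall (m : 'X_{1..nvars r s}) (u : 'I_(nvars r s)),
        act rho 'X_[F, m] = 'X_[F, m] ->
        (U_(u) <= m)%MM ->
        hilbert_ideal act ('X_u * 'X_[m])
    & (* (c) *)
      forall (m : 'X_{1..nvars r s}) (u1 u2 : 'I_(nvars r s)) (c : F),
        act rho 'X_[F, m] = 'X_[F, m] ->
        (U_(u1) *+ 2 <= m)%MM ->
        act rho 'X_u1 = c *: 'X_u1 ->
        act rho 'X_u2 = c *: 'X_u2 ->
        hilbert_ideal act ('X_[m] * 'X_u2)].
Proof.
pose tau := perm (can_inj (@swap_varK r s)); pose w := @var_weight r s F lambda.
have tauE i : tau i = swap_var i by rewrite permE.
have p_gt0 : (0 < p)%N by lia.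
have tauK : involutive tau by move=> i; rewrite !tauE swap_varK.
have tau_neq i : tau i != i by rewrite tauE swap_var_neq.
have sigmaX i : act sigma 'X_i = 'X_(tau i).
  rewrite tauE; move: i; apply: nvars_ind => a; rewrite swap_varE;
  by first [case: (hsigma_xy a) | case: (hsigma_zw a)].
have rhoX i : act rho 'X_i = w i *: 'X_i.
  rewrite /w; move: i; apply: nvars_ind => a; rewrite var_weightE ?scale1r;
  by first [case: (hrho_xy a) | case: (hrho_zw a)].
have w_tau i : w (tau i) = (w i)^-1.
  rewrite tauE /w; move: i.
  by apply: nvars_ind => a; rewrite swap_varE !var_weightE ?invrK ?invr1.
have wp i : w i ^+ p = 1.
  rewrite /w; move: i; apply: nvars_ind => a; rewrite var_weightE ?expr1n //;
  by have [lambda_p _] := hlambda a; rewrite ?exprVn lambda_p ?invr1.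
have w_neq0 i : w i != 0 by exact: unity_neq0 p_gt0 (wp i).
split.
- exact: (hilbert_ideal_low_degree hgen hact tauK tau_neq sigmaX rhoX w_tau
            w_neq0 (ltnW hp3) wp hchar).
- move=> m u rho_m.
  apply: (hilbert_var_mul hgen hact tauK sigmaX rhoX w_tau w_neq0).
  exact: (rho_mpolyX_weight rhoX rho_m).
- move=> m u1 u2 c rho_m le_um rho_u1 rho_u2.
  have eigen u : act rho 'X_u = c *: 'X_u -> w u = c.
    move/(congr1 (mcoeff U_(u))); rewrite rhoX !mcoeffZ mcoeffX eqxx.
    by rewrite !mulr1.
  apply: (hilbert_mul_var hgen hact tauK sigmaX rhoX w_tau w_neq0 _ le_um).
    exact: (rho_mpolyX_weight rhoX rho_m).
  by rewrite !eigen.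
Qed.
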